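(* Suppose $\mathbb{K}$ has a countable separating subset. A Scott function $\varphi$ on $\mathbb{K}$ is infinitely divisible if and only if $\varphi$ has a L\'{e}vy exponent $\Phi$.
   Context: A dcpo is a poset in which every (nonempty) directed subset has a supremum. In a dcpo, $x\ll y$ means that every directed $E$ with $y\le\sup E$ contains some $w$ with $x\le w$. A domain is a dcpo in which, for each $x$, the set $\{z: z\ll x\}$ is a directed lower set with supremum $x$. A subset $U$ is Scott open if it is an upper set and meets every directed $E$ with $\sup E\in U$; an open filter is a nonempty, down-directed Scott open set. $\mathbb{K}$ is a domain which is also a lattice with top element $\hat1$, such that $\hat1\ll\hat1$ and $\ll$ is multiplicative: $a\ll x$, $b\ll y$ imply $a\wedge b\ll x\wedge y$. A subset $Q\subseteq\mathbb{K}$ is separating if $x\ll y$ implies $x\le q\le y$ for some $q\in Q$. An open filter $\mathbb{V}$ of $\mathbb{K}$ is itself a domain and a lattice with these properties. A Scott function is a function $\varphi:\mathbb{K}\to[0,\infty)$ with $\varphi(x)=\sup_{z\ll x}\varphi(z)$ for all $x$ (in particular increasing), normalized by $\varphi(\hat1)=1$. A conjugate (Scott function) on $\mathbb{V}$ is a function $\Phi:\mathbb{V}\to[0,\infty)$ with $\Phi(x)=\inf\{\Phi(z): z\in\mathbb{V},\,z\ll x\}$ for all $x\in\mathbb{V}$ (in particular decreasing), normalized by $\Phi(\hat1)=0$. Put $\nabla_z\phi(x)=\phi(x)-\phi(x\wedge z)$, $\nabla_{z_1,\ldots,z_n}\phi=\nabla_{z_n}(\nabla_{z_1,\ldots,z_{n-1}}\phi)$,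 denoted $\nabla_A\phi$ for $A=\{z_1,\ldots,z_n\}$. An increasing $\phi$ is completely monotone if $\nabla_A\phi\ge0$, and a decreasing $\phi$ is completely alternating if $\nabla_A\phi\le0$, for every nonempty finite $A$. $\varphi$ is infinitely divisible if for every integer $n\ge1$ there is a completely monotone Scott function $\varphi_{(n)}$ on $\mathbb{K}$ with $\varphi=(\varphi_{(n)})^n$. $\Phi$ is a L\'{e}vy exponent of $\varphi$ if for some open filter $\mathbb{V}$ of $\mathbb{K}$, $\Phi$ is a completely alternating conjugate on $\mathbb{V}$ and $\varphi(x)=\exp[-\Phi(x)]$ for $x\in\mathbb{V}$, $\varphi(x)=0$ for $x\in\mathbb{K}\setminus\mathbb{V}$. *)

(* Defs.v *)
From mathcomp Require Import all_boot all_order all_algebra.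
From mathcomp Require Import mathcomp_extra boolp classical_sets cardinality.
From mathcomp Require Import reals sequences exp.

Set Implicit Arguments.
Unset Strict Implicit.
Unset Printing Implicit Defensive.

Import Order.TTheory GRing.Theory Num.Theory.
Local Open Scope classical_set_scope.
Local Open Scope ring_scope.

Section Poset.
Context {disp : Order.disp_t} {P : porderType disp}.
Implicit Types (x y z s : P) (E U : set P).

Definition directed E :=
  E !=set0 /\
  forall x y, E x -> E y -> exists z, [/\ E z, (x <= z)%O & (y <= z)%O].

Definition down_directed E :=
  E !=set0 /\
  forall x y, E x -> E y -> exists z, [/\ E z, (z <= x)%O & (z <= y)%O].

Definition upper_set U := forall x y, (x <= y)%O -> U x -> U y.
Definition lower_set U := forall x y, (x <= y)%O -> U y -> U x.

(* "s = sup E" is rendered relationally by [supremums E s], as the library's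
   [supremum] and [sup] take default values when no supremum exists. *)
Definition way_below x y :=
  forall E s, directed E -> supremums E s -> (y <= s)%O ->
    exists2 w, E w & (x <= w)%O.

Definition scott_open U :=
  upper_set U /\
  forall E s, directed E -> supremums E s -> U s -> (E `&` U) !=set0.

Definition open_filter U := [/\ U !=set0, down_directed U & scott_open U].

Definition separating (Q : set P) :=
  forall x y, way_below x y -> exists q, [/\ Q q, (x <= q)%O & (q <= y)%O].

End Poset.

Notation "x '<<<' y" := (way_below x y) (at level 70, no associativity).

Definition dcpo {disp : Order.disp_t} (P : porderType disp) :=
  forall E : set P, directed E -> exists s, supremums E s.

Definition domain {disp : Order.disp_t} (P : porderType disp) :=
  dcpo P /\
  forall x : P, [/\ directed [set z | z <<< x],
                    lower_set [set z | z <<< x] &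
                    supremums [set z | z <<< x] x].

Definition way_below_multiplicative {disp : Order.disp_t} (K : latticeType disp) :=
  forall a b x y : K, a <<< x -> b <<< y ->
    (Order.meet a b) <<< (Order.meet x y).

Section ScottFunctions.
Context {R : realType} {disp : Order.disp_t} {K : tLatticeType disp}.
Implicit Types (phi : K -> R) (V : set K).

Definition scott_function phi :=
  [/\ forall x, 0 <= phi x,
      forall x, supremums [set phi z | z in [set z | z <<< x]] (phi x) &
      phi \top%O = 1].

(* A function on V is represented by a total function on K whose values off V
   are unconstrained and never used.  For an open filter V and x, z in V, the
   way-below relation of the poset V agrees with that of K. *)
Definition conjugate_scott_function V (Phi : K -> R) :=
  [/\ forall x, V x -> 0 <= Phi x,
      forall x, V x ->
        infimums [set Phi z | z in [set z | V z /\ z <<< x]] (Phi x) &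
      Phi \top%O = 0].

Definition nabla (z : K) phi : K -> R :=
  fun x => phi x - phi (Order.meet x z).

(* The operators [nabla z] commute and are idempotent, so [nablas A phi]
   depends only on the finite set of elements of the sequence A. *)
Definition nablas (A : seq K) phi : K -> R :=
  foldl (fun f z => nabla z f) phi A.

Definition completely_monotone phi :=
  (forall x y, (x <= y)%O -> phi x <= phi y) /\
  forall A : seq K, A != [::] -> forall x, 0 <= nablas A phi x.

(* An open filter V is closed under meets, so only values of Phi on V occur. *)
Definition completely_alternating V (Phi : K -> R) :=
  (forall x y, V x -> V y -> (x <= y)%O -> Phi y <= Phi x) /\
  forall A : seq K, A != [::] -> (forall z, z \in A -> V z) ->
    forall x, V x -> nablas A Phi x <= 0.

Definition infinitely_divisible phi :=
  forall n : nat, (0 < n)%N ->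
    exists psi : K -> R,
      [/\ scott_function psi, completely_monotone psi &
          forall x, phi x = psi x ^+ n].

Definition levy_exponent phi (Phi : K -> R) :=
  exists V : set K,
    [/\ open_filter V,
        conjugate_scott_function V Phi,
        completely_alternating V Phi,
        forall x, V x -> phi x = expR (- Phi x) &
        forall x, ~ V x -> phi x = 0].

End ScottFunctions.

(* Main.v *)
Require Import Defs.
From mathcomp Require Import all_boot all_order all_algebra.
From mathcomp Require Import mathcomp_extra boolp classical_sets cardinality.
From mathcomp Require Import reals topology normedtype sequences exp.
From mathcomp Require Import lra.

Set Implicit Arguments.
Unset Strict Implicit.
Unset Printing Implicit Defensive.

Import Order.TTheory GRing.Theory Num.Theory.
Import numFieldNormedType.Exports.
Local Open Scope classical_set_scope.
Local Open Scope ring_scope.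

(** If [phi] is infinitely divisible, the [n]-th root of [phi] is completely
    monotone for every [n], and [n (phi^(1/n) - 1)] tends to [ln phi] where
    [phi > 0]; hence [Phi = - ln phi] is completely alternating there.  The
    set [phi > 0] is closed under meets because a completely monotone [psi]
    with [psi 1 = 1] satisfies [psi (x /\ y) >= psi x + psi y - 1], and the
    [n]-th roots of [phi x] and [phi y] tend to 1.

    Conversely, completely monotone functions form a cone that is closed under
    products (by the Leibniz rule for [nabla]) and pointwise limits, hence
    under exponentials.  A difference of [exp (- Phi / n)] only involves values
    above a single [m] in [V], and there [(Phi m - Phi) / n] is nonnegative,
    hence completely monotone; so [exp (- Phi / n)] is completely monotone on
    [V].  Extending by zero outside a filter preserves complete
    monotonicity. *)

(** * Limits of roots of a positive real *)

Section RootLimits.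
Context {R : realType}.
Implicit Types a : R.

Lemma cvg_root a : 0 < a -> (a `^ n.+1%:R^-1) @[n --> \oo] --> (1 : R).
Proof.
move=> a0; under eq_fun do rewrite /powR gt_eqF //.
have : (n.+1%:R^-1 * ln a) @[n --> \oo] --> 0 * ln a.
  by apply: cvgM; [exact: cvg_harmonic | exact: cvg_cst].
rewrite mul0r => /(continuous_cvg _ (@continuous_expR R 0)).
by rewrite expR0.
Qed.

(** With [u] the root, [ln v <= v - 1] at [v = u] and at [v = u^-1] squeezes the sequence between
    [ln a] and [ln a * u], and [u] tends to 1. *)
Lemma cvg_root_ln a : 0 < a ->
  (n.+1%:R * (a `^ n.+1%:R^-1 - 1)) @[n --> \oo] --> ln a.
Proof.
move=> a0.
apply: (@squeeze_cvgr _ _ _ _ (fun=> ln a)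
          (fun n : nat => ln a * a `^ n.+1%:R^-1)).
- apply: nearW => n; set u := a `^ _.
  have u0 : 0 < u by exact: powR_gt0.
  have -> : ln a = n.+1%:R * ln u by rewrite ln_powR mulrA divff ?mul1r// pnatr_eq0.
  have ln_ub (v : R) : 0 < v -> ln v <= v - 1.
    move=> v0; have := @le_ln1Dx R (v - 1); rewrite [1 + _]addrC subrK; apply.
    by rewrite ltrBrDr addNr.
  rewrite -mulrA !ler_pM2l// ln_ub//=.
  have := ln_ub u^-1; rewrite invr_gt0 lnV ?posrE// => /(_ u0).
  by rewrite -(ler_pM2r u0) mulrBl mulVf ?gt_eqF// mul1r mulNr lerNl opprB.
- exact: cvg_cst.
- have : ln a * a `^ n.+1%:R^-1 @[n --> \oo] --> ln a * 1.
    by apply: cvgM; [exact: cvg_cst | exact: cvg_root].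
  by rewrite mulr1.
Qed.

End RootLimits.

(** * Iterated differences and the cone of completely monotone functions *)

Section Differences.
Context {R : realType} {disp : Order.disp_t} {K : tLatticeType disp}.
Implicit Types (f g : K -> R) (V : set K) (A : seq K).

Lemma nabla_meetr f z w :
  nabla w (fun x => f (Order.meet x z)) = fun x => nabla w f (Order.meet x z).
Proof. by apply/funext => x; rewrite /nabla meetAC. Qed.

Lemma nablas_meetr A f z x :
  nablas A (fun x => f (Order.meet x z)) x = nablas A f (Order.meet x z).
Proof.
elim: A f => [//|w A IH] f.
by rewrite /nablas /= nabla_meetr; exact: IH.
Qed.

Lemma nabla_mul f g z :
  nabla z (fun x => f x * g x) =
  fun x => nabla z f x * g x + f (Order.meet x z) * nabla z g x.
Proof.
by apply/funext => x; rewrite /nabla mulrBl mulrBr addrA subrK.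
Qed.

Lemma nablasD A f g x :
  nablas A (fun x => f x + g x) x = nablas A f x + nablas A g x.
Proof.
elim: A f g => [//|z A IH] f g.
rewrite /nablas /= -/(nablas A _ x) -/(nablas A _ x) -/(nablas A _ x) -IH.
by congr (nablas A _ x); apply/funext => y; rewrite /nabla opprD addrACA.
Qed.

Lemma nablasZ A c f x : nablas A (fun x => c * f x) x = c * nablas A f x.
Proof.
elim: A f => [//|z A IH] f.
rewrite /nablas /= -/(nablas A _ x) -/(nablas A _ x) -IH.
by congr (nablas A _ x); apply/funext => y; rewrite /nabla mulrBr.
Qed.

Lemma nablas_cst A c x : A != [::] -> nablas A (fun=> c : R) x = 0.
Proof.
have nablas0 B : nablas B (fun=> 0 : R) x = 0.
  elim: B => [//|z B IH]; rewrite /nablas /= -/(nablas B _ x) -[RHS]IH.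
  by congr (nablas B _ x); apply/funext => y; rewrite /nabla subrr.
case: A => // z A _; rewrite -[RHS](nablas0 A).
by rewrite /nablas /=; congr (nablas A _ x); apply/funext => y; rewrite /nabla subrr.
Qed.

Definition meet_closed V := forall x y, V x -> V y -> V (Order.meet x y).

Lemma open_filter_meet_closed V : open_filter V -> meet_closed V.
Proof.
move=> [_ [_ Vdir] [Vup _]] x y Vx Vy.
have [z [Vz zx zy]] := Vdir x y Vx Vy.
by apply: Vup Vz; rewrite lexI zx.
Qed.

(** An iterated difference is a finite combination of values at meets of [x] with elements of [A],
    all in [V], so pointwise convergence on [V] is enough. *)
Lemma nablas_cvg V A (f_ : nat -> K -> R) g x : meet_closed V ->
  (forall z, z \in A -> V z) -> V x ->
  (forall y, V y -> f_ n y @[n --> \oo] --> g y) ->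
  nablas A (f_ n) x @[n --> \oo] --> nablas A g x.
Proof.
move=> VI; elim: A f_ g => [|z A IH] f_ g AV Vx fg; first exact: fg.
rewrite /nablas /=; apply: (IH (fun n => nabla z (f_ n))) => // [w wA|y Vy].
  by apply: AV; rewrite inE wA orbT.
have Vz : V z by apply: AV; rewrite mem_head.
by apply: cvgB; apply: fg => //; exact: VI.
Qed.

Lemma eq_nablas V A f g x : meet_closed V ->
  (forall z, z \in A -> V z) -> V x ->
  (forall y, V y -> f y = g y) -> nablas A f x = nablas A g x.
Proof.
move=> VI; elim: A f g => [|z A IH] f g AV Vx fg; first exact: fg.
rewrite /nablas /=; apply: IH => // [w wA|y Vy].
  by apply: AV; rewrite inE wA orbT.
have Vz : V z by apply: AV; rewrite mem_head.
by rewrite /nabla !fg//; exact: VI.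
Qed.

(* The case [A = [::]] is included, so that [f] is also nonnegative on [V]. *)
Definition completely_monotone_on V f :=
  forall A, (forall z, z \in A -> V z) -> forall x, V x -> 0 <= nablas A f x.

Lemma completely_monotone_on_nabla V f z : V z ->
  completely_monotone_on V f -> completely_monotone_on V (nabla z f).
Proof.
move=> Vz fV A AV x Vx; apply: (fV (z :: A)) => // w.
by rewrite inE => /predU1P[->|/AV].
Qed.

Lemma completely_monotone_on_meetr V f z : meet_closed V -> V z ->
  completely_monotone_on V f ->
  completely_monotone_on V (fun x => f (Order.meet x z)).
Proof.
by move=> VI Vz fV A AV x Vx; rewrite nablas_meetr; apply: fV => //; exact: VI.
Qed.

(** The Leibniz rule splits [nabla z] of a product into two products whose factors are again
    completely monotone, one of them a shift by [z]; the induction therefore generalizes over [f]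
    and [g]. *)
Lemma completely_monotone_onM V f g : meet_closed V ->
  completely_monotone_on V f -> completely_monotone_on V g ->
  completely_monotone_on V (fun x => f x * g x).
Proof.
move=> VI fV gV A; elim: A f g fV gV => [|z A IH] f g fV gV AV x Vx.
  by apply: mulr_ge0; [exact: (fV [::]) | exact: (gV [::])].
have Vz : V z by apply: AV; rewrite mem_head.
have {}AV w : w \in A -> V w by move=> wA; apply: AV; rewrite inE wA orbT.
rewrite /nablas /= nabla_mul -/(nablas A _ x) nablasD.
apply: addr_ge0; apply: IH => //; try exact: completely_monotone_on_nabla.
exact: completely_monotone_on_meetr.
Qed.

Lemma completely_monotone_on_cst V c : 0 <= c ->
  completely_monotone_on V (fun=> c).
Proof. by move=> c0 [//|z A] _ x _; rewrite nablas_cst. Qed.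

Lemma completely_monotone_onX V f n : meet_closed V ->
  completely_monotone_on V f -> completely_monotone_on V (fun x => f x ^+ n).
Proof.
move=> VI fV; elim: n => [|n IH].
  under eq_fun do rewrite expr0.
  exact: completely_monotone_on_cst.
by under eq_fun do rewrite exprS; exact: completely_monotone_onM.
Qed.

Lemma completely_monotone_on_cvg V (f_ : nat -> K -> R) g : meet_closed V ->
  (forall n, completely_monotone_on V (f_ n)) ->
  (forall y, V y -> f_ n y @[n --> \oo] --> g y) ->
  completely_monotone_on V g.
Proof.
move=> VI f_V fg A AV x Vx.
have fgA : nablas A (f_ n) x @[n --> \oo] --> nablas A g x by exact: (nablas_cvg VI AV Vx fg).
rewrite -(cvg_lim _ fgA)//; apply: limr_ge.
  by apply/cvg_ex; eexists; exact: fgA.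
by apply: nearW => n; exact: f_V.
Qed.

(** The partial sums of the exponential series are nonnegative combinations of powers of [f]. *)
Lemma completely_monotone_on_expR V f : meet_closed V ->
  completely_monotone_on V f -> completely_monotone_on V (fun x => expR (f x)).
Proof.
move=> VI fV.
apply: (@completely_monotone_on_cvg V (fun n x => series (exp_coeff (f x)) n)) => //.
  elim=> [|n IH].
    under eq_fun do rewrite /series /= big_geq//.
    exact: completely_monotone_on_cst.
  under eq_fun do rewrite seriesSr.
  move=> A AV x Vx; rewrite nablasD addr_ge0 ?IH//.
  have exp_term : completely_monotone_on V (fun x => f x ^+ n * n`!%:R^-1).
    apply: (completely_monotone_onM VI (completely_monotone_onX n VI fV)).
    by apply: completely_monotone_on_cst; rewrite invr_ge0.
  exact: exp_term.
by move=> y _; exact: is_cvg_series_exp_coeff.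
Qed.

Lemma completely_monotone_on_expRN V f c : meet_closed V -> 0 <= c ->
  completely_alternating V f ->
  completely_monotone_on V (fun x => expR (- (c * f x))).
Proof.
move=> VI c0 [fle fV] A AV x Vx.
(* [m] is a lower bound in [V] of all points at which the difference evaluates [f]. *)
set m := foldr Order.meet x A.
have [mx mA Vm] : [/\ (m <= x)%O, forall z, z \in A -> (m <= z)%O & V m].
  rewrite /m; elim: A AV {m} => [//|z A IH] AV /=.
  have Vz : V z by apply: AV; rewrite mem_head.
  have [|mx mA Vm] := IH; first by move=> w wA; apply: AV; rewrite inE wA orbT.
  split=> [|w|]; [by rewrite (le_trans (leIr _ _)) | | exact: VI].
  by rewrite inE => /predU1P[->|/mA]; [exact: leIl | exact: le_trans (leIr _ _)].
pose W := [set y | V y /\ (m <= y)%O].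
have WI : meet_closed W.
  by move=> y z [Vy my] [Vz mz]; split; [exact: VI | rewrite lexI my].
(* On [W] the function [f] is at most [f m], which settles the empty difference; in a nonempty one
   the constant [c * f m] cancels. *)
have shiftW : completely_monotone_on W (fun y => c * f m + - c * f y).
  move=> [|z B] BW y [Vy my].
    by rewrite /= mulNr -mulrBr mulr_ge0// subr_ge0 fle.
  rewrite nablasD nablas_cst// add0r nablasZ mulNr -mulrN mulr_ge0// oppr_ge0.
  by apply: fV => // w /BW[].
(* A positive constant factor compensates for the shift by [c * f m]. *)
have -> : (fun y => expR (- (c * f y))) =
          (fun y => expR (- (c * f m)) * expR (c * f m + - c * f y)).
  by apply/funext => y; rewrite -expRD addrA addNr add0r mulNr.
have factorW : completely_monotone_on W (fun=> expR (- (c * f m))).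
  by apply: completely_monotone_on_cst; exact: expR_ge0.
apply: (completely_monotone_onM WI factorW (completely_monotone_on_expR WI shiftW)).
- by move=> z zA; split; [exact: AV | exact: mA].
- by split.
Qed.

(** A difference along [z] outside [V] leaves [f] unchanged, since [f] vanishes at all meets with
    [z]; along [z] in [V] both hypotheses pass to [nabla z f]. *)
Lemma completely_monotone_on_extend0 V f : upper_set V ->
  completely_monotone_on V f -> (forall x, ~ V x -> f x = 0) ->
  completely_monotone_on setT f.
Proof.
move=> Vup fV f0 A _ x _; elim: A f fV f0 => [|z A IH] f fV f0.
  have [Vx|Vx] := pselect (V x); [exact: (fV [::]) | by rewrite /nablas /= f0].
have VIl y w : ~ V y -> ~ V (Order.meet y w) by move=> Vy /(Vup _ _ (leIl _ _)).
apply: IH => [|y Vy]; last by rewrite /nabla !f0 ?subrr//; exact: VIl.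
have [Vz|Vz] := pselect (V z); first exact: completely_monotone_on_nabla.
suff -> : nabla z f = f by [].
by apply/funext => y; rewrite /nabla (f0 (Order.meet y z)) ?subr0// meetC; exact: VIl.
Qed.

End Differences.

(** * Roots of Scott functions and the two implications *)

Section ScottFunctionTheory.
Context {R : realType} {disp : Order.disp_t} {K : tLatticeType disp}.
Context (K_domain : domain K).
Implicit Types (phi psi : K -> R).

Lemma scott_function_le phi x y :
  scott_function phi -> (x <= y)%O -> phi x <= phi y.
Proof.
move=> [_ phi_sup _] xy; have [_ lub_x] := phi_sup x; apply: lub_x.
move=> _ [z zx <-]; have [ub_y _] := phi_sup y; apply: ub_y; exists z => //.
by move=> E s Edir Es ys; apply: zx Edir Es (le_trans xy ys).
Qed.

Lemma scott_function_le1 phi x : scott_function phi -> phi x <= 1.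
Proof.
by move=> phiS; have [_ _ <-] := phiS; apply: scott_function_le => //; exact: lex1.
Qed.

Lemma scott_function_root phi n : scott_function phi ->
  scott_function (fun x => phi x `^ n.+1%:R^-1).
Proof.
move=> phiS; have [phi0 phi_sup phi1] := phiS; split=> [x|x|].
- exact: powR_ge0.
- split=> [_ [z zx <-]|c ub_c].
    rewrite ge0_ler_powR ?nnegrE ?invr_ge0//.
    by have [ub_x _] := phi_sup x; apply: ub_x; exists z.
  (* Some [z0 <<< x] exists, so the upper bound [c] is nonnegative and can be compared through its
     power [c ^+ n.+1]. *)
  have [[z0 z0x] _] : directed [set z | z <<< x] by have [] := K_domain.2 x.
  have c0 : 0 <= c.
    exact: le_trans (powR_ge0 _ _) (ub_c _ (ex_intro2 _ _ z0 z0x erefl)).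
  have root_expn (b : R) : 0 <= b -> b = (b ^+ n.+1) `^ n.+1%:R^-1.
    by move=> b0; rewrite -powR_mulrn// -powRrM divff ?pnatr_eq0// powRr1.
  rewrite (root_expn c c0) ge0_ler_powR ?nnegrE ?invr_ge0 ?exprn_ge0//.
  have [_ lub_x] := phi_sup x; apply: lub_x => _ [z zx <-].
  have -> : phi z = (phi z `^ n.+1%:R^-1) ^+ n.+1.
    by rewrite -powR_mulrn ?powR_ge0// -powRrM mulVf ?pnatr_eq0// powRr1.
  by rewrite lerXn2r ?nnegrE ?powR_ge0//; apply: ub_c; exists z.
- by rewrite phi1 powR1.
Qed.

(** Nonnegative roots are unique, so the existential witness can only be the real power of [phi]. *)
Lemma infinitely_divisible_root phi : scott_function phi ->
  infinitely_divisible phi <->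
  forall n : nat, completely_monotone (fun x => phi x `^ n.+1%:R^-1).
Proof.
move=> phiS; have [phi0 _ _] := phiS; split=> [phi_div n|phi_cm [//|n] _].
  have [psi [[psi0 _ _] psi_cm phiE]] := phi_div n.+1 isT.
  suff -> : (fun x => phi x `^ n.+1%:R^-1) = psi by [].
  by apply/funext => x; rewrite phiE -powR_mulrn// -powRrM divff ?pnatr_eq0// powRr1.
exists (fun x => phi x `^ n.+1%:R^-1); split => // [|x].
  exact: scott_function_root.
by rewrite -powR_mulrn ?powR_ge0// -powRrM mulVf ?pnatr_eq0// powRr1.
Qed.

Lemma support_open_filter phi : scott_function phi ->
  infinitely_divisible phi -> open_filter [set x | 0 < phi x].
Proof.
move=> phiS phi_div; have [phi0 phi_sup phi1] := phiS; split.
- by exists \top%O; rewrite /= phi1.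
- split=> [|x y x0 y0]; first by exists \top%O; rewrite /= phi1.
  exists (Order.meet x y); rewrite leIl leIr; split => //=.
  rewrite lt_neqAle phi0 andbT eq_sym; apply/eqP => xy0.
  (* Once both roots exceed 1/2, the difference along [x] and [y] at the top equals 1 minus their
     sum, as the term at the meet is 0; it is negative, a contradiction. *)
  have half_lt1 : 2^-1 < 1 :> R by rewrite invf_lt1// ltr1n.
  have root_gt (a : R) : 0 < a -> \forall n \near \oo, 2^-1 < a `^ n.+1%:R^-1.
    by move=> /cvg_root/cvgr_gt; apply.
  have [n [xn yn]] :
      exists n, 2^-1 < phi x `^ n.+1%:R^-1 /\ 2^-1 < phi y `^ n.+1%:R^-1.
    by apply: (@filter_ex _ \oo); apply: filterI; exact: root_gt.
  have [_ /(_ [:: x; y] isT \top%O)] :=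
    (infinitely_divisible_root phiS).1 phi_div n.
  rewrite /nablas /= /nabla !meet1x meetC xy0 phi1 powR1 powR0 ?invr_eq0 ?pnatr_eq0//.
  rewrite subr0 leNgt => /negP; apply.
  lra.
- split=> [x y xy /=|E s Edir Es /= s0].
    by move/lt_le_trans; apply; exact: scott_function_le.
  have [z zs z0] : exists2 z, z <<< s & 0 < phi z.
    apply: contrapT => none; have [_ lub_s] := phi_sup s.
    suff : phi s <= 0 by rewrite leNgt s0.
    apply: lub_s => _ [z zs <-]; rewrite leNgt; apply/negP => z0.
    by apply: none; exists z.
  have [w Ew zw] := zs E s Edir Es (lexx s).
  by exists w; split => //=; apply: lt_le_trans z0 _; exact: scott_function_le.
Qed.

Lemma levy_exponent_ln phi : scott_function phi ->
  infinitely_divisible phi -> levy_exponent phi (fun x => - ln (phi x)).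
Proof.
move=> phiS phi_div; have [phi0 phi_sup phi1] := phiS.
have Vfilter := support_open_filter phiS phi_div.
have VI := open_filter_meet_closed Vfilter.
exists [set x | 0 < phi x]; split => //.
- split => [x _|x x0|]; last by rewrite phi1 ln1 oppr0.
    by rewrite oppr_ge0 ln_le0// scott_function_le1.
  split=> [_ [z [z0 zx] <-]|c lb_c].
    rewrite lerN2 ler_ln ?posrE//.
    by have [ub_x _] := phi_sup x; apply: ub_x; exists z.
  rewrite lerNr -ler_expR lnK ?posrE//.
  have [_ lub_x] := phi_sup x; apply: lub_x => _ [z zx <-].
  (* The bound [lb_c] covers only [z] in the support; elsewhere [phi z <= 0] lies below any
     exponential. *)
  have [z0|] := ltP 0 (phi z); last by move/le_trans; apply; exact: expR_ge0.
  rewrite -[leLHS]lnK ?posrE// ler_expR lerNr.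
  by apply: lb_c; exists z.
- split=> [x y x0 y0 xy|A A0 AV x x0].
    by rewrite lerN2 ler_ln ?posrE//; exact: scott_function_le.
  (* These approximants of [- ln (phi y)] are negative multiples of a root plus a constant, and
     nonempty differences kill the constant. *)
  pose f_ n y := - n.+1%:R * (phi y `^ n.+1%:R^-1 + - 1).
  have f_cvg : nablas A (f_ n) x @[n --> \oo] --> nablas A (fun y => - ln (phi y)) x.
    apply: (nablas_cvg VI AV x0) => y y0; rewrite /f_.
    by under eq_fun do rewrite mulNr; apply: cvgN; exact: cvg_root_ln.
  rewrite -(cvg_lim _ f_cvg)//; apply: limr_le.
    by apply/cvg_ex; eexists; exact: f_cvg.
  apply: nearW => n.
  rewrite /f_ nablasZ nablasD nablas_cst// addr0 mulNr oppr_le0 mulr_ge0//.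
  by have [_] := (infinitely_divisible_root phiS).1 phi_div n; apply.
- by move=> x x0; rewrite opprK lnK.
- by move=> x /negP; rewrite -leNgt => x0; apply/eqP; rewrite eq_le x0 phi0.
Qed.

Lemma levy_exponent_infinitely_divisible phi Phi : scott_function phi ->
  levy_exponent phi Phi -> infinitely_divisible phi.
Proof.
move=> phiS [V [Vfilter _ PhiV phiV phi0]].
have VI := open_filter_meet_closed Vfilter.
have [_ _ [Vup _]] := Vfilter.
apply/infinitely_divisible_root => // n; split=> [x y xy|A _ x].
  exact: (scott_function_le (scott_function_root n phiS) xy).
apply: (completely_monotone_on_extend0 Vup) => // [{A x}A AV x Vx|y Vy].
  rewrite (eq_nablas (g := fun y => expR (- (n.+1%:R^-1 * Phi y))) VI) //.
    by apply: (completely_monotone_on_expRN VI _ PhiV) => //; rewrite invr_ge0.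
  by move=> y Vy; rewrite phiV// -expRM mulrC mulrN.
(* The exponent must be nonzero here, because a zero exponent would give the value 1 at 0. *)
by rewrite phi0// powR0// invr_eq0 pnatr_eq0.
Qed.

End ScottFunctionTheory.

Theorem proposition9p2 (R : realType) (disp : Order.disp_t)
    (K : tLatticeType disp)
    (K_domain : domain K)
    (K_top : (\top%O : K) <<< (\top%O : K))
    (K_mult : way_below_multiplicative K)
    (K_sep : exists Q : set K, countable Q /\ separating Q)
    (phi : K -> R) (phi_scott : scott_function phi) :
  infinitely_divisible phi <-> exists Phi : K -> R, levy_exponent phi Phi.
Proof.
split=> [phi_div|[Phi]].
  by exists (fun x => - ln (phi x)); exact: levy_exponent_ln.
exact: levy_exponent_infinitely_divisible.
Qed.
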